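(* Let $F$ be a $p$-adic field of characteristic $0$ with ring of integers $\mathcal{O}_F$, let $G=\mathrm{GL}_n(F)$ and $K=\mathrm{GL}_n(\mathcal{O}_F)$. Let $\mathcal{S}_{\mathrm{std}}(G,K)$ be the space of restrictions to $G$ of the bi-$K$-invariant functions in $C_c^\infty(\mathrm{M}_n(F))$. Then $$\mathcal{S}_{\mathrm{std}}(G,K)=1_{\mathrm{M}_n(\mathcal{O}_F)}*\mathcal{H}(G,K).$$
   Context: $C_c^\infty(\mathrm{M}_n(F))$ is the space of locally constant compactly supported functions on the space $\mathrm{M}_n(F)$ of $n\times n$ matrices. $1_{\mathrm{M}_n(\mathcal{O}_F)}$ is the characteristic function of $\mathrm{M}_n(\mathcal{O}_F)$ (restricted to $G$). $\mathcal{H}(G,K)$ is the spherical Hecke algebra of compactly supported bi-$K$-invariant functions on $G$, and $*$ is convolution on $G$ with respect to a Haar measure. *)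

(* Defs.v *)
From HB Require Import structures.
From mathcomp Require Import all_boot all_order all_algebra.
From mathcomp Require Import all_classical all_reals all_analysis.
From mathcomp Require Import complex.

Set Implicit Arguments.
Unset Strict Implicit.
Unset Printing Implicit Defensive.

Import Order.TTheory GRing.Theory Num.Theory.

Local Open Scope classical_set_scope.
Local Open Scope ring_scope.

(* "v x >= k", with the convention v 0 = +oo; the value of v at 0 is junk. *)
Definition val_ge (F : fieldType) (v : F -> int) (k : int) (x : F) : bool :=
  (x == 0) || (k <= v x).

(* A p-adic field of characteristic 0 is a field of characteristic 0 that is
   complete for a (normalized) discrete valuation with finite residue field.
   The topology is that of the valuation: the sets
   {(x, y) | v (x - y) >= k}, k : int, are a base of entourages.  Completeness
   is spelled out because the library's completeType also has a base point. *)
HB.mixin Record isPadicField F of GRing.Field F & Uniform F := {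
  valuation : F -> int ;
  valuationM : forall x y, x != 0 -> y != 0 ->
    valuation (x * y) = valuation x + valuation y ;
  valuationD : forall x y, x != 0 -> y != 0 -> x + y != 0 ->
    Num.min (valuation x) (valuation y) <= valuation (x + y) ;
  valuation_normalized : exists2 pi, pi != 0 & valuation pi = 1 ;
  entourage_valuation : @entourage F = filter_from [set: int]
    (fun k => [set xy : F * F | val_ge valuation k (xy.1 - xy.2)]) ;
  padic_complete : forall E : set_system F,
    ProperFilter E -> cauchy E -> exists x : F, E --> x ;
  (* finitely many classes of integers modulo the maximal ideal *)
  finite_residue_field : exists s : seq F, forall x, val_ge valuation 0 x ->
    exists2 y, y \in s & val_ge valuation 1 (x - y) ;
  padic_pchar0 : [pchar F] =i pred0
}.

#[short(type="padicFieldType")]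
HB.structure Definition PadicField :=
  {F of GRing.Field F & Uniform F & isPadicField F}.

Definition integers (F : padicFieldType) : {pred F} :=
  [pred x | val_ge (@valuation F) 0 x].
Arguments integers F : clear implicits.

Definition GL (n : nat) (F : padicFieldType) : Type :=
  {g : 'M[F]_n | g \in unitmx}.

Section GL_structures.
Variables (n : nat) (F : padicFieldType).

HB.instance Definition _ := SubType.copy (GL n F) {g : 'M[F]_n | g \in unitmx}.
HB.instance Definition _ := [Choice of GL n F by <:].

Definition GL_one : GL n F := Sub 1%:M (@unitmx1 F n).

Lemma GL_mul_subproof (g h : GL n F) : val g *m val h \in unitmx.
Proof. by rewrite unitmx_mul (valP g) (valP h). Qed.

Definition GL_mul (g h : GL n F) : GL n F :=
  Sub (val g *m val h) (GL_mul_subproof g h).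

Lemma GL_inv_subproof (g : GL n F) : invmx (val g) \in unitmx.
Proof. by rewrite unitmx_inv (valP g). Qed.

Definition GL_inv (g : GL n F) : GL n F := Sub (invmx (val g)) (GL_inv_subproof g).

Lemma GL_mulA : associative GL_mul.
Proof. by move=> x y z; apply/val_inj; rewrite !SubK mulmxA. Qed.

Lemma GL_mul1 : left_id GL_one GL_mul.
Proof. by move=> x; apply/val_inj; rewrite !SubK mul1mx. Qed.

Lemma GL_mulx1 : right_id GL_one GL_mul.
Proof. by move=> x; apply/val_inj; rewrite !SubK mulmx1. Qed.

Lemma GL_mulV : left_inverse GL_one GL_inv GL_mul.
Proof. by move=> x; apply/val_inj; rewrite !SubK mulVmx // (valP x). Qed.

Lemma GL_mulxV : right_inverse GL_one GL_inv GL_mul.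
Proof. by move=> x; apply/val_inj; rewrite !SubK mulmxV // (valP x). Qed.

HB.instance Definition _ := isGroup.Build (GL n F)
  GL_mulA GL_mul1 GL_mulx1 GL_mulV GL_mulxV.

HB.instance Definition _ := isPointed.Build (GL n F) GL_one.

(* Inversion is continuous on invertible matrices, so that the topology induced
   by M_n(F) is the group topology of GL_n(F). *)
HB.instance Definition _ := Topological.copy (GL n F)
  (initial_topology (val : GL n F -> 'M[F]_n)).

End GL_structures.

Definition borelGL (n : nat) (F : padicFieldType) :=
  g_sigma_algebraType (@open (GL n F)).

Section functions.
Variable R : realType.

Definition locally_constant (T : topologicalType) (f : T -> R[i]) : Prop :=
  forall x : T, \forall y \near x, f y = f x.

Definition compactly_supported (T : topologicalType) (f : T -> R[i]) : Prop :=
  compact (closure [set x | f x != 0]).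

Definition Cc_infty (T : topologicalType) : set (T -> R[i]) :=
  [set f | locally_constant f /\ compactly_supported f].

Variables (n : nat) (F : padicFieldType).

Definition GLO : set (GL n F) :=
  [set k : GL n F | val k \is a mxOver (integers F) /\
           val (k^-1)%g \is a mxOver (integers F)].

Definition bi_invariant (f : GL n F -> R[i]) : Prop :=
  forall k1 k2 g : GL n F, GLO k1 -> GLO k2 -> f (k1 * g * k2)%g = f g.

Definition bi_invariant_mx (f : 'M[F]_n -> R[i]) : Prop :=
  forall (k1 k2 : GL n F) (x : 'M[F]_n), GLO k1 -> GLO k2 ->
    f (val k1 *m x *m val k2) = f x.

Definition hecke_algebra : set (GL n F -> R[i]) :=
  [set h | bi_invariant h /\ compactly_supported h].

Definition S_std : set (GL n F -> R[i]) :=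
  [set (fun g => phi (val g)) | phi in
    [set phi : 'M[F]_n -> R[i] | Cc_infty phi /\ bi_invariant_mx phi]].

Definition one_MnO : GL n F -> R[i] :=
  fun g => (val g \is a mxOver (integers F))%:R.

Definition is_Haar (mu : {measure set (borelGL n F) -> \bar R}) : Prop :=
  [/\ forall (g : GL n F) (A : set (borelGL n F)), measurable A ->
        mu [set (g * (x : GL n F))%g | x in A] = mu A,
      forall A : set (GL n F), compact A -> (mu A < +oo)%E
    & forall A : set (GL n F), open A -> A !=set0 -> (0 < mu A)%E].

Definition Cintegral (mu : {measure set (borelGL n F) -> \bar R})
    (f : GL n F -> R[i]) : R[i] :=
  (Rintegral mu setT (fun x => complex.Re (f x)) +i*
   Rintegral mu setT (fun x => complex.Im (f x)))%C.

Definition convolution (mu : {measure set (borelGL n F) -> \bar R})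
    (f h : GL n F -> R[i]) : GL n F -> R[i] :=
  fun g => Cintegral mu (fun x => f x * h (x^-1 * g)%g).

End functions.

Arguments GLO {n F}.
Arguments one_MnO {R} n F.
Arguments hecke_algebra R n F : clear implicits.
Arguments S_std R n F : clear implicits.

(* Main.v *)
(** Left [K]-cosets of [G] are lattices of row vectors: [K g] corresponds to the
    lattice spanned by the rows of [g], and [m y^-1] is integral iff the rows of
    the matrix [m] lie in the lattice of [y].  Hence, up to the volume of [K],
    the convolution of [1_{M_n(O)}] with [h] is the finite sum
      [m |-> \sum_(y in K \ G) h y * [rows of m lie in the lattice of y]],
    which makes sense for every [m] in [M_n(F)] and is a bi-[K]-invariant
    Schwartz function.

    Conversely, a left [K]-invariant Schwartz function depends only on the row
    lattice [M] of its argument.  Being supported on [M <= pi^-N O^n] and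
    invariant under translation by [pi^N M_n(O)], it is determined by its values
    on the finitely many lattices between [pi^N O^n] and [pi^-N O^n], because
    [M] may be replaced by [M + pi^N O^n].  On this finite poset, Moebius
    inversion produces the required [h]. *)

Require Import Defs.
From mathcomp Require Import all_boot all_order all_algebra all_fingroup.
From mathcomp Require Import all_classical all_reals all_analysis.
From mathcomp Require Import measurable_realfun complex.
From mathcomp Require Import zify.

Set Implicit Arguments.
Unset Strict Implicit.
Unset Printing Implicit Defensive.

Import Order.TTheory GRing.Theory Num.Theory.

Local Open Scope classical_set_scope.
Local Open Scope ring_scope.

(** * Valuations of scalars and matrices *)

Section Valuation.
Variable F : padicFieldType.
Implicit Types (x y : F) (k l : int).

Notation v := (@valuation F).
Notation vge := (val_ge v).

Lemma vge0 k : vge k 0.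
Proof. by rewrite /val_ge eqxx. Qed.

Lemma valuation1 : v 1 = 0.
Proof.
have := @valuationM F 1 1 (oner_neq0 _) (oner_neq0 _).
by rewrite mulr1 -[X in X = _]addr0 => /addrI.
Qed.

Lemma vge1 : vge 0 1.
Proof. by rewrite /val_ge valuation1 lexx orbT. Qed.

Lemma vgeW k l x : vge k x -> l <= k -> vge l x.
Proof.
by rewrite /val_ge => /orP[->//|kx] lk; rewrite (le_trans lk kx) orbT.
Qed.

Lemma vgeM k l x y : vge k x -> vge l y -> vge (k + l) (x * y).
Proof.
have [->|x0] := eqVneq x 0; first by rewrite mul0r !vge0.
have [->|y0] := eqVneq y 0; first by rewrite mulr0 !vge0.
rewrite /val_ge mulf_eq0 (negbTE x0) (negbTE y0) /= valuationM //.
exact: lerD.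
Qed.

Lemma valuationN1 : v (-1) = 0.
Proof.
have N0 : -1 != 0 :> F by rewrite oppr_eq0 oner_neq0.
have := valuationM _ _ N0 N0.
by rewrite mulrNN mulr1 valuation1; set a := v _ => h; lia.
Qed.

Lemma vgeN k x : vge k x -> vge k (- x).
Proof.
rewrite -mulN1r -[k in X in _ -> X]add0r; apply: vgeM.
by rewrite /val_ge valuationN1 lexx orbT.
Qed.

Lemma vgeD k x y : vge k x -> vge k y -> vge k (x + y).
Proof.
have [->|x0] := eqVneq x 0; first by rewrite add0r.
have [->|y0] := eqVneq y 0; first by rewrite addr0.
have [->|xy0] := eqVneq (x + y) 0; first by rewrite vge0.
rewrite /val_ge (negbTE x0) (negbTE y0) (negbTE xy0) /= => kx ky.
by apply: le_trans (valuationD _ _ x0 y0 xy0); rewrite le_min kx ky.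
Qed.

Lemma vgeB k x y : vge k x -> vge k y -> vge k (x - y).
Proof. by move=> kx ky; apply: vgeD => //; apply: vgeN. Qed.

Lemma vge_sum k (I : Type) (r : seq I) (P : pred I) (f : I -> F) :
  (forall i, P i -> vge k (f i)) -> vge k (\sum_(i <- r | P i) f i).
Proof.
by move=> h; elim/big_ind: _ => //; [exact: vge0|exact: vgeD].
Qed.

Lemma valuationV x : x != 0 -> v x^-1 = - v x.
Proof.
move=> x0; have xV0 : x^-1 != 0 by rewrite invr_eq0.
have := valuationM _ _ x0 xV0; rewrite divff // valuation1 => h.
by apply/eqP; rewrite -addr_eq0 addrC -h.
Qed.

Lemma vge_val k x : x != 0 -> vge k x = (k <= v x).
Proof. by rewrite /val_ge => /negbTE->. Qed.

Lemma ex_valuation k : exists2 x, x != 0 & v x = k.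
Proof.
have [p p0 vp] := @valuation_normalized F.
have vX (m : nat) : v (p ^+ m) = m%:Z.
  elim: m => [|m IH]; first by rewrite expr0 valuation1.
  by rewrite exprS valuationM ?expf_neq0 // vp IH; lia.
case: k => m.
  by exists (p ^+ m); [rewrite expf_neq0|rewrite vX].
exists (p ^+ m.+1)^-1; first by rewrite invr_eq0 expf_neq0.
by rewrite valuationV ?expf_neq0 // vX; lia.
Qed.

Lemma vge_eq0 x : (forall k, vge k x) -> x = 0.
Proof.
move=> h; apply/eqP; apply: contraT => x0.
by have := h (v x + 1); rewrite vge_val //; lia.
Qed.

Lemma vge_lb x : exists k, vge k x.
Proof. by exists (v x); rewrite /val_ge lexx orbT. Qed.

(** Induction on [d]: after rescaling by an element of valuation [k + d], finiteness of the residue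
    field splits each ball of level [k + d] into finitely many of level [k + d + 1]. *)
Lemma vge_totally_bounded k (d : nat) : exists s : seq F,
  forall x, vge k x -> exists2 y, y \in s & vge (k + d%:Z) (x - y).
Proof.
elim: d => [|d [s hs]].
  by exists [:: 0] => x kx; exists 0; rewrite ?inE // !subr0.
have [r hr] := @finite_residue_field F.
have [p p0 vp] := ex_valuation (k + d%:Z).
exists [seq y + p * z | y <- s, z <- r] => x /hs[y ys hy].
have /hr[z zr hz] : vge 0 ((x - y) / p).
  rewrite -(subrr (k + d%:Z)); apply: vgeM => //.
  by rewrite vge_val ?invr_eq0 // valuationV // vp.
exists (y + p * z); first by apply/allpairsP; exists (y, z).
have -> : x - (y + p * z) = p * ((x - y) / p - z).
  by rewrite mulrBr [p * (_ / _)]mulrC divfK // opprD addrA.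
have -> : k + d.+1%:Z = k + d%:Z + 1 by lia.
by apply: vgeM => //; rewrite vge_val // vp.
Qed.

Lemma nbhs_valuation x (A : set F) :
  nbhs x A <-> exists k, forall y, vge k (y - x) -> A y.
Proof.
split.
  rewrite -nbhs_entourageE => -[E]; rewrite entourage_valuation.
  move=> [k _ kE] EA; exists k => y ky; apply/EA/xsectionP/kE => /=.
  by rewrite -opprB; apply: vgeN.
move=> [k kA]; rewrite -nbhs_entourageE.
exists [set xy | vge k (xy.1 - xy.2)].
  by rewrite entourage_valuation; exists k.
move=> y /xsectionP /= ky; apply: kA.
by rewrite -opprB; apply: vgeN.
Qed.

(* Compactness of a ball, stated through the dichotomy property of ultrafilters
   since that property passes to pushforwards at once. *)
Lemma vge_ultra_cvg k (U : set_system F) : ProperFilter U ->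
  (forall A : set F, U A \/ U (~` A)) -> U [set x | vge k x] ->
  exists2 x, vge k x & forall l, U [set y | vge l (y - x)].
Proof.
move=> UF Uu Uk.
(* An ultrafilter containing a finite union contains one of its pieces. *)
have Useq (s : seq F) (P : F -> F -> Prop) :
    U [set x | exists2 y, y \in s & P x y] -> exists y, U [set x | P x y].
  elim: s => [|y s IH] Us.
    by have /filter_ex[? []] := Us.
  have [yU|nyU] := Uu [set x | P x y]; first by exists y.
  apply: IH; apply: filterS2 Us nyU => x [z].
  by rewrite inE => /orP[/eqP->//|zs Pxz _]; exists z.
have Ubig l : exists y, U [set x | vge l (x - y)].
  have [s hs] := vge_totally_bounded k (absz (l - k)).
  apply: (Useq s (fun x y => vge l (x - y))).
  apply: filterS Uk => x /hs[y ys xy]; exists y => //.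
  by apply: vgeW xy _; lia.
(* [U] contains a ball of every level, hence is Cauchy, and completeness supplies the limit. *)
have Ucauchy : cauchy U.
  move=> E; rewrite nbhs_simpl /= entourage_valuation => -[l _ lE].
  have [y Uy] := Ubig l.
  exists ([set x | vge l (x - y)], [set x | vge l (x - y)]) => //.
  move=> [a b] /= [ay byy]; apply: lE => /=.
  have -> : a - b = (a - y) - (b - y) by rewrite opprB addrA subrK.
  exact: vgeB.
have [x Ux] := padic_complete _ UF Ucauchy.
have {}Ux l : U [set y | vge l (y - x)].
  by apply: Ux; apply/nbhs_valuation; exists l.
exists x => //.
have [y [ky yx]] := filter_ex (filterI Uk (Ux k)).
by rewrite -[x](subKr y); apply: vgeB.
Qed.

End Valuation.

(** * Matrices with a lower bound on the valuations of their entries *)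

Section MatrixValuation.
Variable F : padicFieldType.
Implicit Types k l : int.

Definition mxge k (m n : nat) (A : 'M[F]_(m, n)) : bool :=
  [forall i, forall j, val_ge (@valuation F) k (A i j)].

Lemma mxgeP k m n (A : 'M[F]_(m, n)) :
  reflect (forall i j, val_ge (@valuation F) k (A i j)) (mxge k A).
Proof. exact: 'forall_forallP. Qed.

Lemma mxge0 k m n : mxge k (0 : 'M[F]_(m, n)).
Proof. by apply/mxgeP => i j; rewrite mxE vge0. Qed.

Lemma mxgeW k l m n (A : 'M[F]_(m, n)) : mxge k A -> l <= k -> mxge l A.
Proof. by move=> /mxgeP kA lk; apply/mxgeP => i j; exact: vgeW (kA i j) lk. Qed.

Lemma mxgeD k m n (A B : 'M[F]_(m, n)) : mxge k A -> mxge k B -> mxge k (A + B).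
Proof.
by move=> /mxgeP kA /mxgeP kB; apply/mxgeP => i j; rewrite mxE; apply: vgeD.
Qed.

Lemma mxgeN k m n (A : 'M[F]_(m, n)) : mxge k A -> mxge k (- A).
Proof. by move=> /mxgeP kA; apply/mxgeP => i j; rewrite mxE; apply: vgeN. Qed.

Lemma mxgeB k m n (A B : 'M[F]_(m, n)) : mxge k A -> mxge k B -> mxge k (A - B).
Proof. by move=> kA kB; apply: mxgeD => //; apply: mxgeN. Qed.

Lemma mxgeBC k m n (A B : 'M[F]_(m, n)) : mxge k (A - B) -> mxge k (B - A).
Proof. by rewrite -opprB => /mxgeN; rewrite !opprB. Qed.

Lemma mxge_near k m n (A B : 'M[F]_(m, n)) :
  mxge k (A - B) -> mxge k B -> mxge k A.
Proof. by move=> AB kB; rewrite -[A](subrK B); apply: mxgeD. Qed.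

Lemma mxge_trans k m n (A B C : 'M[F]_(m, n)) :
  mxge k (A - B) -> mxge k (B - C) -> mxge k (A - C).
Proof.
by move=> AB BC; rewrite -[A](subrK B) -addrA; apply: mxgeD.
Qed.

Lemma mxgeM k l m n p (A : 'M[F]_(m, n)) (B : 'M[F]_(n, p)) :
  mxge k A -> mxge l B -> mxge (k + l) (A *m B).
Proof.
move=> /mxgeP kA /mxgeP lB; apply/mxgeP => i j; rewrite mxE.
by apply: vge_sum => r _; apply: vgeM.
Qed.

Lemma mxge0M k m n p (A : 'M[F]_(m, n)) (B : 'M[F]_(n, p)) :
  mxge 0 A -> mxge k B -> mxge k (A *m B).
Proof. by move=> hA hB; rewrite -[k]add0r; apply: mxgeM. Qed.

Lemma mxgeM0 k m n p (A : 'M[F]_(m, n)) (B : 'M[F]_(n, p)) :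
  mxge k A -> mxge 0 B -> mxge k (A *m B).
Proof. by move=> hA hB; rewrite -[k]addr0; apply: mxgeM. Qed.

Lemma mxge_scalar k (x : F) n :
  val_ge (@valuation F) k x -> mxge k (x%:M : 'M[F]_n).
Proof.
move=> kx; apply/mxgeP => i j; rewrite mxE.
by case: eqP => // _; rewrite mulr0n vge0.
Qed.

Lemma mxge1 n : mxge 0 (1%:M : 'M[F]_n).
Proof. exact/mxge_scalar/vge1. Qed.

Lemma mxge_eq0 m n (A : 'M[F]_(m, n)) : (forall k, mxge k A) -> A = 0.
Proof.
move=> h; apply/matrixP => i j; rewrite mxE.
by apply: vge_eq0 => k; exact/mxgeP/h.
Qed.

Lemma mxge_lb m n (A : 'M[F]_(m, n)) : exists N : nat, mxge (- N%:Z) A.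
Proof.
have /choice[f hf] (ij : 'I_m * 'I_n) :
    exists k, val_ge (@valuation F) k (A ij.1 ij.2).
  exact: vge_lb.
exists (\max_ij `|f ij|)%N; apply/mxgeP => i j; apply: (vgeW (hf (i, j))).
have := @leq_bigmax _ (fun ij => absz (f ij)) (i, j); lia.
Qed.

Lemma mxge0P m n (A : 'M[F]_(m, n)) :
  reflect (A \is a mxOver (integers F)) (mxge 0 A).
Proof.
by apply: (iffP (mxgeP _ _)) => h; [apply/mxOverP|move=> i j; apply: (mxOverP h)].
Qed.

(* If [W (1 + X) = 1], then [W = 1 - W X] has smaller denominators than [W]
   as long as [W] is not integral. *)
Lemma mxge_inv_near1 n (X W : 'M[F]_n) :
  mxge 1 X -> W *m (1%:M + X) = 1%:M -> mxge 0 W.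
Proof.
move=> X1; rewrite mulmxDr mulmx1 => WE.
have {}WE : W = 1%:M - W *m X by rewrite -WE addrK.
have [N] := mxge_lb W.
elim: N => [//|N IH] hW; apply: IH; rewrite WE.
apply: mxgeB; first by apply: (mxgeW (mxge1 n)); lia.
by apply: (@mxgeW (- N.+1%:Z + 1)); [exact: mxgeM|lia].
Qed.

Lemma nbhs_mxge m n (A : 'M[F]_(m, n)) (S : set 'M[F]_(m, n)) :
  nbhs A S <-> exists k, forall B, mxge k (B - A) -> S B.
Proof.
split.
  move=> [P AP PS].
  have /choice[f hf] (ij : 'I_m * 'I_n) : exists k, forall y,
      val_ge (@valuation F) k (y - A ij.1 ij.2) -> P ij.1 ij.2 y.
    exact/nbhs_valuation/AP.
  exists (\max_ij `|f ij|)%N%:Z => B AB; apply: PS => i j.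
  apply: (hf (i, j)) => /=; move/mxgeP: AB => /(_ i j).
  rewrite !mxE => /vgeW; apply.
  have := @leq_bigmax _ (fun ij => absz (f ij)) (i, j); lia.
move=> [k kS].
exists (fun i j => [set y | val_ge (@valuation F) k (y - A i j)]).
  by move=> i j; apply/nbhs_valuation; exists k.
by move=> B hB; apply: kS; apply/mxgeP => i j; rewrite !mxE; apply: hB.
Qed.

Lemma mxge_ultra_cvg k m n (U : set_system 'M[F]_(m, n)) : ProperFilter U ->
  (forall A : set 'M[F]_(m, n), U A \/ U (~` A)) -> U (@mxge k m n) ->
  exists2 A, mxge k A & forall l, U [set B | mxge l (B - A)].
Proof.
move=> UF Uu Uk.
have /choice[f hf] (ij : 'I_m * 'I_n) : exists x, val_ge (@valuation F) k x /\
    forall l, U [set B | val_ge (@valuation F) l (B ij.1 ij.2 - x)].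
  pose e (B : 'M[F]_(m, n)) := B ij.1 ij.2.
  have [||x kx xl] := @vge_ultra_cvg F k (e @ U) _.
  - by move=> S; exact: Uu.
  - suff : U [set B | val_ge (@valuation F) k (e B)] by [].
    by apply: filterS Uk => B /mxgeP kB; exact: kB.
  - by exists x.
exists (\matrix_(i, j) f (i, j)).
  by apply/mxgeP => i j; rewrite mxE; have [] := hf (i, j).
move=> l; have : U [set B : 'M[F]_(m, n) | forall ij : 'I_m * 'I_n,
    val_ge (@valuation F) l (B ij.1 ij.2 - f ij)].
  by apply: filter_forall => ij; have [_] := hf ij; apply.
by apply: filterS => B hB; apply/mxgeP => i j; rewrite !mxE; exact: (hB (i, j)).
Qed.

Lemma compact_mxge k m n : compact (@mxge k m n).
Proof.
rewrite compact_ultra => U UU Uk.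
have [|A kA Al] := @mxge_ultra_cvg k m n U _ _ Uk.
  by move=> S; exact: in_ultra_setVsetC.
exists A; split => // S /nbhs_mxge[l lS].
exact: filterS (Al l).
Qed.

Lemma closed_mxge k m n : closed (@mxge k m n).
Proof.
move=> A clA; have [|B [kB]] := clA [set B | mxge k (B - A)].
  by apply/nbhs_mxge; exists k.
by move=> /mxgeBC/mxge_near; apply.
Qed.

End MatrixValuation.

(** Turns compactness into a single numerical bound, used below for supports and for uniform local
    constancy. *)
Lemma compact_increasing_cover (T : topologicalType) (A : set T)
    (U : nat -> set T) :
  compact A -> (forall N, open (U N)) ->
  (forall N M, (N <= M)%N -> U N `<=` U M) ->
  (forall x, A x -> exists N, U N x) -> exists N, A `<=` U N.
Proof.
move=> /compact_near_coveringP Ac Uo Umono AU.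
suff [N _ AUN] : \forall N \near \oo, A `<=` U N.
  by exists N; exact: AUN (leqnn N).
apply: Ac => x Ax; have [N UNx] := AU x Ax.
exists (U N, [set M | (N <= M)%N]) => /=.
  by split; [exact: open_nbhs_nbhs|exists N].
by move=> [y M] [/= UNy NM]; exact: Umono NM _ UNy.
Qed.

(** * Topology of [GL_n(F)] *)

Section GLTopology.
Variables (n : nat) (F : padicFieldType).
Notation G := (GL n F).
Implicit Types (g h k : G) (N : nat).

Lemma val_GLM g h : val (g * h)%g = val g *m val h.
Proof. by []. Qed.

Lemma val_GLV g : val (g^-1)%g = invmx (val g).
Proof. by []. Qed.

Lemma val_GL1 : val (1%g : G) = 1%:M.
Proof. by []. Qed.

Lemma val_mulgV g : val g *m val (g^-1)%g = 1%:M.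
Proof. by rewrite -val_GLM mulgV. Qed.

Lemma val_mulVg g : val (g^-1)%g *m val g = 1%:M.
Proof. by rewrite -val_GLM mulVg. Qed.

Lemma GLO_mxge k : GLO k -> mxge 0 (val k).
Proof. by case=> /mxge0P. Qed.

Lemma GLO_mxgeV k : GLO k -> mxge 0 (val (k^-1)%g).
Proof. by case=> _ /mxge0P. Qed.

Lemma GLOI k : mxge 0 (val k) -> mxge 0 (val (k^-1)%g) -> GLO k.
Proof. by move=> /mxge0P h1 /mxge0P h2. Qed.

Lemma GLO1 : GLO (1%g : G).
Proof. by apply: GLOI; rewrite ?invg1 val_GL1; exact: mxge1. Qed.

Lemma GLOM g h : GLO g -> GLO h -> GLO (g * h)%g.
Proof.
move=> gO hO; apply: GLOI; rewrite ?invgM val_GLM; apply: mxge0M;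
  by [exact: GLO_mxge|exact: GLO_mxgeV].
Qed.

Lemma GLOV g : GLO g -> GLO (g^-1)%g.
Proof. by case=> ? ?; split; rewrite ?invgK. Qed.

Lemma mxge_GLOl k i (p : nat) (A : 'M[F]_(n, p)) : GLO k ->
  mxge i (val k *m A) = mxge i A.
Proof.
move=> kO; apply/idP/idP => h; last exact: mxge0M (GLO_mxge kO) h.
rewrite -[A]mul1mx -(val_mulVg k) -mulmxA.
exact: mxge0M (GLO_mxgeV kO) h.
Qed.

Lemma mxge_GLOr k i (p : nat) (A : 'M[F]_(p, n)) : GLO k ->
  mxge i (A *m val k) = mxge i A.
Proof.
move=> kO; apply/idP/idP => h; last exact: mxgeM0 h (GLO_mxge kO).
rewrite -[A]mulmx1 -(val_mulgV k) mulmxA.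
exact: mxgeM0 h (GLO_mxgeV kO).
Qed.

(* The row lattice of [g] lies between [pi^N O^n] and [pi^-N O^n]. *)
Definition GLge N g : bool :=
  mxge (- N%:Z) (val g) && mxge (- N%:Z) (val (g^-1)%g).

Lemma GLgeW N M g : (N <= M)%N -> GLge N g -> GLge M g.
Proof.
by move=> NM /andP[h1 h2]; apply/andP; split;
  [apply: (mxgeW h1)|apply: (mxgeW h2)]; lia.
Qed.

Lemma GLge_ex g : exists N, GLge N g.
Proof.
have [[N hN] [M hM]] := (mxge_lb (val g), mxge_lb (val (g^-1)%g)).
exists (N + M)%N; apply/andP; split; [apply: (mxgeW hN)|apply: (mxgeW hM)]; lia.
Qed.

Lemma GLgeMl N k g : GLO k -> GLge N (k * g)%g = GLge N g.
Proof.
move=> kO; rewrite /GLge invgM !val_GLM mxge_GLOl // mxge_GLOr //.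
exact: GLOV.
Qed.

Lemma GLgeMr N k g : GLO k -> GLge N (g * k)%g = GLge N g.
Proof.
move=> kO; rewrite /GLge invgM !val_GLM mxge_GLOr // mxge_GLOl //.
exact: GLOV.
Qed.

Lemma GLO_GLge k : GLO k <-> GLge 0 k.
Proof.
rewrite /GLge oppr0; split; last by case/andP; exact: GLOI.
by move=> kO; rewrite GLO_mxge // GLO_mxgeV.
Qed.

Lemma nbhs_GL g (A : set G) :
  nbhs g A <-> exists i, forall h, mxge i (val h - val g) -> A h.
Proof.
split.
  rewrite nbhsE => -[B [[C oC <-] Cg] BA].
  have /nbhs_mxge[i iC] : nbhs (val g) C by apply: open_nbhs_nbhs.
  by exists i => h /iC; apply: BA.
move=> [i iA]; have := @initial_continuous _ _ (val : G -> 'M[F]_n) g.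
move=> /(_ [set B | mxge i (B - val g)]) h.
apply: filterS iA _; apply: h.
by apply/nbhs_mxge; exists i.
Qed.

Lemma GLO_near1 k : mxge 1 (val k - 1%:M) -> GLO k.
Proof.
move=> k1; apply: GLOI.
  by apply: (@mxge_near _ 0 _ _ (val k) 1%:M); [exact: mxgeW k1 _|exact: mxge1].
by apply: (mxge_inv_near1 k1); rewrite addrC subrK val_mulVg.
Qed.

(** The coset [K g] is open: precision [N + 1] absorbs the denominators of [g^-1], leaving [h g^-1]
    congruent to [1] modulo the maximal ideal. *)
Lemma nbhs_GLO_rcoset g : nbhs g [set h | GLO (h * g^-1)%g].
Proof.
have [N hN] := mxge_lb (val (g^-1)%g).
apply/nbhs_GL; exists (N.+1)%:Z => h hg /=; apply: GLO_near1.
rewrite val_GLM -(val_mulgV g) -mulmxBl.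
have -> : 1 = N.+1%:Z + - N%:Z by lia.
exact: mxgeM.
Qed.

Lemma nbhs_GLO_lcoset g : nbhs g [set h | GLO (g^-1 * h)%g].
Proof.
have [N hN] := mxge_lb (val (g^-1)%g).
apply/nbhs_GL; exists (N.+1)%:Z => h hg /=; apply: GLO_near1.
rewrite val_GLM -(val_mulVg g) -mulmxBr.
have -> : 1 = - N%:Z + N.+1%:Z by lia.
exact: mxgeM.
Qed.

Lemma open_GLO_stable (S : set G) :
  (forall k g, GLO k -> S g -> S (k * g)%g) -> open S.
Proof.
move=> hS; rewrite openE => g Sg; rewrite /interior.
apply: filterS (nbhs_GLO_rcoset g) => h /hS /(_ Sg).
by rewrite mulgVK.
Qed.

Lemma closed_GLO_stable (S : set G) :
  (forall k g, GLO k -> S g -> S (k * g)%g) -> closed S.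
Proof.
move=> hS; rewrite -[S]setCK; apply: open_closedC.
apply: open_GLO_stable => k g kO nSg Skg; apply: nSg.
by have := hS _ _ (GLOV kO) Skg; rewrite mulKg.
Qed.

(** Along an ultrafilter both [g] and [g^-1] converge, to [A] and [B] say, and [g g^-1 = 1] passes
    to the limit. The bound on the inverses is what keeps the limit invertible. *)
Lemma compact_GLge N : compact [set g | GLge N g].
Proof.
rewrite compact_ultra => U UU UN.
have Uconv (f : G -> 'M[F]_n) : U [set g | mxge (- N%:Z) (f g)] ->
    exists A, mxge (- N%:Z) A /\ forall l, U [set g | mxge l (f g - A)].
  move=> Uf; have [||A kA Al] := @mxge_ultra_cvg F (- N%:Z) n n (f @ U) _ _ _.
  - by move=> S; exact: (in_ultra_setVsetC (f @^-1` S)).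
  - exact: Uf.
  - by exists A.
have [|A [NA Al]] := Uconv val.
  by apply: filterS UN => g /andP[].
have [|B [NB Bl]] := Uconv (fun g => val (g^-1)%g).
  by apply: filterS UN => g /andP[].
have AB1 : A *m B = 1%:M.
  apply/eqP; rewrite -subr_eq0; apply/eqP/mxge_eq0 => l.
  pose j := l + N%:Z.
  have lj : l <= j + - N%:Z by rewrite addrK.
  have [g [[gA gB] /andP[Ng _]]] :=
    filter_ex (filterI (filterI (Al j) (Bl j)) UN).
  have -> : A *m B - 1%:M =
      (A - val g) *m B + val g *m (B - val (g^-1)%g).
    by rewrite mulmxBl mulmxBr val_mulgV addrA subrK.
  apply: mxgeD; first exact: mxgeW (mxgeM (mxgeBC gA) NB) lj.
  by rewrite addrC in lj; exact: mxgeW (mxgeM Ng (mxgeBC gB)) lj.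
have Au : A \in unitmx by case/mulmx1_unit: AB1.
exists (Sub A Au); split.
  have VA : val ((Sub A Au : G)^-1)%g = B.
    by rewrite val_GLV SubK -[RHS]mul1mx -(mulVmx Au) -mulmxA AB1 mulmx1.
  by rewrite /= /GLge VA SubK NA NB.
move=> S /nbhs_GL[l lS]; apply: filterS (Al l) => g hg.
by apply: lS; rewrite SubK.
Qed.

End GLTopology.

(** * Lattices *)

Section Saturation.
Variable F : padicFieldType.
Implicit Types b : int.

(* The rows of [B] span the lattice generated by the rows of [A] and those of
   a scalar matrix of valuation [b]. *)
Definition saturation b n (A B : 'M[F]_n) : Prop :=
  mxge b (B - A) /\
  (exists2 E, mxge 0 E & A = E *m B) /\
  (exists2 W, mxge (- b) W & W *m B = 1%:M).

(** Lets invertible integral row and column operations be carried out before saturating. *)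
Lemma saturation_equiv b n (A B K K' L L' : 'M[F]_n) :
  mxge 0 K -> mxge 0 K' -> mxge 0 L -> mxge 0 L' ->
  K' *m K = 1%:M -> L' *m L = 1%:M ->
  saturation b A B -> saturation b (K *m A *m L) (K *m B *m L).
Proof.
move=> K0 K'0 L0 L'0 KK LL [AB [[E E0 AE] [W W0 WB]]]; split; last split.
- by rewrite -mulmxBl -mulmxBr mxgeM0 // mxge0M.
- exists (K *m E *m K'); first by rewrite mxgeM0 // mxge0M.
  by rewrite {1}AE !mulmxA -[K *m E *m K' *m K]mulmxA KK mulmx1.
- exists (L' *m W *m K'); first by rewrite mxgeM0 // mxge0M.
  rewrite !mulmxA -[_ *m K' *m K]mulmxA KK mulmx1 -[L' *m W *m B]mulmxA WB.
  by rewrite mulmx1.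
Qed.

Lemma mxge_block k m1 m2 n1 n2 (A : 'M[F]_(m1, n1)) (B : 'M[F]_(m1, n2))
    (C : 'M[F]_(m2, n1)) (D : 'M[F]_(m2, n2)) :
  mxge k A -> mxge k B -> mxge k C -> mxge k D -> mxge k (block_mx A B C D).
Proof.
move=> /mxgeP hA /mxgeP hB /mxgeP hC /mxgeP hD; apply/mxgeP => i j.
by rewrite !mxE; case: (fintype.split i) => ?; rewrite !mxE;
  case: (fintype.split j).
Qed.

Lemma mxge_tperm n (i j : 'I_n) : mxge 0 (tperm_mx i j : 'M[F]_n).
Proof.
by apply/mxgeP => u w; rewrite !mxE; case: (_ == _); rewrite ?vge1 ?vge0.
Qed.

Lemma tperm_mxK n (i j : 'I_n) : tperm_mx i j *m tperm_mx i j = 1%:M :> 'M[F]_n.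
Proof. by rewrite -perm_mxM tperm2 perm_mx1. Qed.

(** Gaussian elimination over the integers, stopped at precision [b]: a non-zero pivot of least
    valuation divides all entries, so its row and column are cleared integrally, and the Schur
    complement is handled by induction. *)
Lemma saturation_ex b n (A : 'M[F]_n) : exists B, saturation b A B.
Proof.
elim: n A => [|n IH] A.
  exists A; split; first by rewrite subrr mxge0.
  split; first by exists 1%:M; rewrite ?mul1mx ?mxge1.
  by exists 0; [exact: mxge0|rewrite [LHS]flatmx0 [RHS]flatmx0].
have [Ab|Ab] := boolP (mxge b A).
  have [t t0 vt] := ex_valuation F b.
  have tV : mxge (- b) (t^-1%:M : 'M[F]_n.+1).
    by apply: mxge_scalar; rewrite vge_val ?invr_eq0 // valuationV // vt.
  exists t%:M; split; last split.
  - by apply: mxgeB => //; apply: mxge_scalar; rewrite vge_val // vt.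
  - exists (A *m t^-1%:M); first by rewrite -(subrr b); apply: mxgeM.
    by rewrite -mulmxA -scalar_mxM mulVf // mulmx1.
  - by exists t^-1%:M => //; rewrite -scalar_mxM mulVf.
have [[i0 j0] /= a0 [ab amin]] : exists2 ij, A ij.1 ij.2 != 0 &
    valuation (A ij.1 ij.2) < b /\
    forall i j, val_ge valuation (valuation (A ij.1 ij.2)) (A i j).
  have /existsNP[i /existsNP[j /negP]] := elimN (mxgeP _ _) Ab.
  rewrite negb_or -ltNge => /andP[Aij0 Aijb].
  case: (@Order.TotalTheory.arg_minP _ _ _ (i, j) (fun ij => A ij.1 ij.2 != 0)
    (fun ij => valuation (A ij.1 ij.2)) Aij0) => ij ij0 hij.
  exists ij => //; split; first exact: le_lt_trans (hij (i, j) Aij0) Aijb.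
  move=> i' j'; rewrite /val_ge; case: eqVneq => //= h.
  exact: (hij (i', j')).
set a := A i0 j0 in a0 ab amin.
pose A1 : 'M[F]_(1 + n) := xrow 0 i0 (xcol 0 j0 A).
have A1a : mxge (valuation a) A1.
  by rewrite /A1; apply/mxgeP => i j; rewrite !mxE.
have AA1 : A = tperm_mx 0 i0 *m A1 *m tperm_mx 0 j0.
  rewrite /A1 xrowE xcolE !mulmxA tperm_mxK mul1mx -mulmxA.
  by rewrite tperm_mxK mulmx1.
suff [B AB] : exists B, saturation b A1 B.
  exists (tperm_mx 0 i0 *m B *m tperm_mx 0 j0); rewrite AA1.
  by apply: (saturation_equiv (K' := tperm_mx 0 i0) (L' := tperm_mx 0 j0)) AB;
    rewrite ?tperm_mxK ?mxge_tperm.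
have A100 : ulsubmx A1 = a%:M.
  by rewrite [LHS]mx11_scalar !mxE /= !lshift0 !tpermL.
have [r [s [t [A1E r0 s0]]]] : exists r s t,
    [/\ A1 = block_mx a%:M (a *: r) (a *: s) t, mxge 0 r & mxge 0 s].
  have aV : val_ge valuation (- valuation a) a^-1.
    by rewrite vge_val ?invr_eq0 // valuationV.
  exists (a^-1 *: ursubmx A1), (a^-1 *: dlsubmx A1), (drsubmx A1); split.
  - by rewrite !scalerA divff // !scale1r -A100 submxK.
  - apply/mxgeP => i j; rewrite !mxE -(addNr (valuation a)).
    by apply: vgeM => //; apply: amin.
  - apply/mxgeP => i j; rewrite !mxE -(addNr (valuation a)).
    by apply: vgeM => //; apply: amin.
have [t' [t't [[E E0 tE] [W W0 Wt']]]] := IH (t - a *: (s *m r)).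
pose L (s : 'M[F]_(n, 1)) : 'M[F]_(1 + n) := block_mx 1%:M 0 s 1%:M.
pose U (r : 'M[F]_(1, n)) : 'M[F]_(1 + n) := block_mx 1%:M r 0 1%:M.
have LL : L (- s) *m L s = 1%:M.
  rewrite mulmx_block !mul1mx !mul0mx !mulmx0 !mulmx1 !addr0 add0r addNr.
  by rewrite -scalar_mx_block.
have UU : U (- r) *m U r = 1%:M.
  rewrite mulmx_block !mul1mx !mul0mx !mulmx0 !mulmx1 !addr0 !add0r subrr.
  by rewrite -scalar_mx_block.
have -> : A1 = L s *m block_mx a%:M 0 0 (t - a *: (s *m r)) *m U r.
  rewrite A1E !mulmx_block !mul1mx !mul0mx !mulmx0 !mulmx1 !addr0 !add0r.
  by rewrite mul_scalar_mx mul_mx_scalar -scalemxAl addrC subrK.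
exists (L s *m block_mx a%:M 0 0 t' *m U r).
apply: (saturation_equiv (K' := L (- s)) (L' := U (- r))) => //.
- by apply: mxge_block; rewrite ?mxge1 ?mxge0.
- by apply: mxge_block; rewrite ?mxge1 ?mxge0 ?mxgeN.
- by apply: mxge_block; rewrite ?mxge1 ?mxge0.
- by apply: mxge_block; rewrite ?mxge1 ?mxge0 ?mxgeN.
split; last split.
- by rewrite opp_block_mx add_block_mx !subrr mxge_block ?mxge0.
- exists (block_mx 1%:M 0 0 E); first by rewrite mxge_block ?mxge1 ?mxge0.
  by rewrite mulmx_block !mul1mx !mul0mx !mulmx0 !addr0 add0r -tE.
(* The pivot has valuation below [b], so its inverse meets the bound [- b]. *)
- exists (block_mx a^-1%:M 0 0 W).
    rewrite mxge_block ?mxge0 // mxge_scalar //.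
    by rewrite vge_val ?invr_eq0 // valuationV // lerN2 ltW.
  rewrite mulmx_block !mul0mx !mulmx0 !addr0 add0r Wt' -scalar_mxM mulVf //.
  by rewrite -scalar_mx_block.
Qed.

End Saturation.

(** * Representatives of the bounded cosets in [K \ G] *)

Section CosetRepresentatives.
Variables (n : nat) (F : padicFieldType).
Notation G := (GL n F).
Implicit Types (g h k : G) (N : nat).

(** The choice is made from the coset [K g] as a set, so it depends on the coset alone; the fallback
    [1] is never reached, since [g] lies in its own coset. *)
Definition coset_rep g : G := xget 1%g [set h | GLO (h * g^-1)%g].

Lemma coset_repP g : GLO (coset_rep g * g^-1)%g.
Proof.
rewrite /coset_rep; case: xgetP => // /(_ g) /=.
by rewrite mulgV => /(_ (GLO1 n F)).
Qed.

Lemma coset_rep_eqP g h : coset_rep g = coset_rep h <-> GLO (g * h^-1)%g.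
Proof.
split=> [gh|gh].
  have -> : (g * h^-1 = (coset_rep g * g^-1)^-1 * (coset_rep h * h^-1))%g.
    by rewrite gh invgM invgK mulgA mulgVK.
  by apply: GLOM; [apply: GLOV|]; exact: coset_repP.
congr (xget 1%g _); apply/seteqP; split => u /= uO.
  by rewrite -(mulgVK g u) -mulgA; apply: GLOM.
have -> : (u * g^-1 = (u * h^-1) * (g * h^-1)^-1)%g.
  by rewrite invgM invgK mulgA mulgVK.
by apply: GLOM => //; apply: GLOV.
Qed.

Lemma coset_repK g : coset_rep (coset_rep g) = coset_rep g.
Proof. exact/coset_rep_eqP/coset_repP. Qed.

(** The open cosets [K h] cover the compact set [GLge N], which is stable under [K]; a finite
    subcover leaves finitely many representatives. *)
Lemma reps_subproof N : exists s : seq G,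
  uniq s /\ forall g, (g \in s) <-> GLge N g /\ coset_rep g = g.
Proof.
have := @compact_GLge n F N; rewrite compact_cover.
move=> /(_ _ [set h | GLge N h] (fun h => [set g | GLO (g * h^-1)%g])).
case=> [h _| g gN |D DN Dcov].
- by apply: open_GLO_stable => k g kO gO; rewrite /= -mulgA; apply: GLOM.
- by exists g => //=; rewrite mulgV; exact: GLO1.
exists (undup [seq coset_rep h | h <- finmap.enum_fset D]).
split; first exact: undup_uniq.
move=> g; rewrite mem_undup; split.
  case/mapP => h hD ->; split; last exact: coset_repK.
  rewrite -(mulgVK h (coset_rep h)) GLgeMl; last exact: coset_repP.
  by have := DN h hD; rewrite inE.
move=> [gN gE]; have [h hD gh] := Dcov g gN.
by apply/mapP; exists h => //; rewrite -gE; apply/coset_rep_eqP.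
Qed.

Definition reps N : seq G := sval (cid (reps_subproof N)).

Lemma reps_uniq N : uniq (reps N).
Proof. by rewrite /reps; case: cid => s /= []. Qed.

Lemma mem_reps N g : (g \in reps N) <-> GLge N g /\ coset_rep g = g.
Proof. by rewrite /reps; case: cid => s /= []. Qed.

Lemma coset_rep_reps N g : (coset_rep g \in reps N) = GLge N g.
Proof.
have gO := coset_repP g; apply/idP/idP.
  by case/mem_reps; rewrite -(mulgVK g (coset_rep g)) GLgeMl.
move=> gN; apply/mem_reps; rewrite coset_repK; split => //.
by rewrite -(mulgVK g (coset_rep g)) GLgeMl.
Qed.

Lemma coset_repE (T : Type) (f : G -> T) g :
  (forall k h, GLO k -> f (k * h)%g = f h) -> f (coset_rep g) = f g.
Proof.
by move=> hf; rewrite -(mulgVK g (coset_rep g)) hf //; exact: coset_repP.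
Qed.

(** Right translation by [K] preserves [GLge N] and permutes its cosets [K y], and [f] sees only
    these cosets. *)
Lemma sum_repsMr (V : nmodType) N (f : G -> V) k :
  (forall k h, GLO k -> f (k * h)%g = f h) -> GLO k ->
  \sum_(y <- reps N) f (y * k)%g = \sum_(y <- reps N) f y.
Proof.
move=> hf kO; pose r y := coset_rep (y * k)%g.
have -> : \sum_(y <- reps N) f (y * k)%g = \sum_(y <- reps N) f (r y).
  by apply: eq_bigr => y _; rewrite /r coset_repE.
rewrite -(big_map r xpredT f); apply: perm_big; apply: uniq_perm.
- rewrite map_inj_in_uniq ?reps_uniq // => x y /mem_reps[_ <-] /mem_reps[_ <-].
  move=> /coset_rep_eqP; rewrite invgM mulgA mulgK => /coset_rep_eqP.
  by rewrite !coset_repK.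
- exact: reps_uniq.
move=> x; apply/mapP/idP => [[y /mem_reps[yN _] ->]|xs].
  by rewrite coset_rep_reps GLgeMr.
have [xN xE] := (mem_reps N x).1 xs.
exists (coset_rep (x * k^-1)%g).
  by rewrite coset_rep_reps GLgeMr //; exact: GLOV.
rewrite /r -[LHS]xE; apply/coset_rep_eqP; rewrite invgM mulgA.
by have := GLOV (coset_repP (x * k^-1)%g); rewrite invgM invgK.
Qed.

End CosetRepresentatives.

(** * Convolution as a finite sum over lattices *)

Lemma integrable_indic_fin d (T : measurableType d) (R : realType)
    (mu : {measure set T -> \bar R}) (A : set T) :
  measurable A -> (mu A < +oo)%E ->
  mu.-integrable setT (EFin \o (\1_A : T -> R)).
Proof.
move=> mA Afin; apply/integrableP; split.
  by apply/measurable_EFinP; exact: measurable_indic.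
rewrite (eq_integral (fun x => (\1_A x)%:E)) ?integral_indic ?setIT //.
by move=> x _; rewrite /= ger0_norm.
Qed.

Lemma Rintegral_sum_indic d (T : measurableType d) (R : realType)
    (mu : {measure set T -> \bar R}) (I : Type) (s : seq I) (r : I -> R)
    (A : I -> set T) :
  (forall i, measurable (A i)) -> (forall i, (mu (A i) < +oo)%E) ->
  Rintegral mu setT (fun x => \sum_(i <- s) r i * \1_(A i) x) =
  \sum_(i <- s) r i * fine (mu (A i)).
Proof.
move=> mA Afin.
have iA i : mu.-integrable setT (EFin \o (fun x => r i * \1_(A i) x)).
  have := integrableZl measurableT (r i) (integrable_indic_fin (mA i) (Afin i)).
  by apply: eq_integrable => // x _ /=; rewrite EFinM.
elim: s => [|i s IH].
  under eq_Rintegral do rewrite big_nil.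
  by rewrite Rintegral_cst // mul0r big_nil.
under eq_Rintegral do rewrite big_cons.
rewrite RintegralD //.
  rewrite IH big_cons RintegralZl ?(integrable_indic_fin (mA i)) //.
  by rewrite /Rintegral integral_indic // setIT.
have := integrable_sum measurableT s (P := xpredT) (fun i _ => iA i).
by apply: eq_integrable => // x _ /=; rewrite sumEFin.
Qed.

Section Convolution.
Variables (R : realType) (n : nat) (F : padicFieldType).
Notation G := (GL n F).
Variable mu : {measure set (borelGL n F) -> \bar R}.
Hypothesis mu_Haar : is_Haar mu.

Definition vol_GLO : R := fine (mu (GLO : set G)).

Lemma measurable_GLO_stable (S : set G) :
  (forall k g, GLO k -> S g -> S (k * g)%g) ->
  measurable (S : set (borelGL n F)).
Proof. by move=> hS; apply: sub_sigma_algebra; apply: open_GLO_stable. Qed.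

Lemma compact_GLO : compact (GLO : set G).
Proof.
have -> : GLO = [set k : G | GLge 0 k].
  by apply/seteqP; split => k /GLO_GLge.
exact: compact_GLge.
Qed.

Lemma open_GLO : open (GLO : set G).
Proof. by apply: open_GLO_stable; exact: GLOM. Qed.

Lemma vol_GLO_fin : (mu (GLO : set G) < +oo)%E.
Proof. by case: mu_Haar => _ + _; apply; exact: compact_GLO. Qed.

Lemma vol_GLO_neq0 : vol_GLO != 0.
Proof.
have [_ _ /(_ _ open_GLO)] := mu_Haar.
have GLO_neq0 : (GLO : set G) !=set0 by exists 1%g; exact: GLO1.
move=> /(_ GLO_neq0) mu_gt0; apply: lt0r_neq0; apply: fine_gt0.
by rewrite mu_gt0 vol_GLO_fin.
Qed.

Lemma lcoset_GLO (g : G) :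
  [set x | GLO (g^-1 * x)%g] = [set (g * (x : G))%g | x in GLO].
Proof.
apply/seteqP; split => [x xO|_ [x xO <-]] /=; last by rewrite mulKg.
by exists (g^-1 * x)%g => //; rewrite mulVKg.
Qed.

Lemma measurable_lcoset_GLO (g : G) :
  measurable ([set x | GLO (g^-1 * x)%g] : set (borelGL n F)).
Proof.
apply: sub_sigma_algebra; rewrite openE => x xO; rewrite /interior.
apply: filterS (nbhs_GLO_lcoset x) => y /= yO.
by rewrite -(mulVKg x y) mulgA; apply: GLOM.
Qed.

Lemma mu_lcoset_GLO (g : G) :
  mu [set x | GLO (g^-1 * x)%g] = mu (GLO : set G).
Proof.
rewrite lcoset_GLO; case: mu_Haar => + _ _; apply.
by apply: measurable_GLO_stable; exact: GLOM.
Qed.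

(** [x^-1 g] lies in [K y] exactly when [x] lies in [g y^-1 K]. On that left coset the integrand is
    constant, and by left invariance its measure is that of [K]. *)
Lemma convolution_one_MnOE (h : G -> R[i]) N (g : G) :
  bi_invariant h -> (forall x, h x != 0 -> GLge N x) ->
  convolution mu (one_MnO n F) h g = (vol_GLO%:C)%C *
   \sum_(y <- reps n F N) h y * (mxge 0 (val g *m val (y^-1)%g))%:R.
Proof.
move=> h_inv hN.
pose c y := h y * (mxge 0 (val g *m val (y^-1)%g))%:R.
pose A (y : G) : set (borelGL n F) := [set x | GLO ((g * y^-1)^-1 * x)%g].
(* At a given [x] at most one indicator is non-zero, that of the representative of [K x^-1 g]. *)
have fE x : one_MnO n F x * h (x^-1 * g)%g =
    \sum_(y <- reps n F N) c y * (\1_(A y) x : R)%:C%C.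
  pose y0 := coset_rep (x^-1 * g)%g.
  have Ay y : y \in reps n F N -> (\1_(A y) x : R)%:C%C = (y == y0)%:R.
    move=> /mem_reps[_ yE]; rewrite indicE.
    have -> : (x \in A y) = (y == y0).
      have xA : A y x <-> y = y0.
        rewrite -{2}yE /y0; rewrite coset_rep_eqP /A /=.
        by rewrite !invgM !invgK -!mulgA.
      by apply/idP/eqP; rewrite inE => /xA.
    by case: (y == y0).
  rewrite (eq_big_seq (fun y => c y * (y == y0)%:R)); last first.
    by move=> y /Ay ->.
  have hE : h y0 = h (x^-1 * g)%g.
    apply: coset_repE => k u kO.
    by have := h_inv k 1%g u kO (GLO1 n F); rewrite mulg1.
  have [y0s|y0s] := boolP (y0 \in reps n F N).
    rewrite (bigD1_seq y0) ?reps_uniq //= eqxx mulr1.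
    rewrite big1 ?addr0; last by move=> y /negbTE->; rewrite mulr0.
    rewrite /c hE mulrC /one_MnO; congr (_ * (nat_of_bool _)%:R).
    have -> : (val x \is a mxOver (integers F)) = mxge 0 (val x).
      by apply/idP/idP => /mxge0P.
    (* [x] and [g y0^-1] differ by a right factor in [K], so they are integral together. *)
    have -> : x = (g * y0^-1 * (y0 * (x^-1 * g)^-1))%g.
      by rewrite mulgA mulgVK invgM invgK mulgA mulgV mul1g.
    by rewrite val_GLM mxge_GLOr //; exact: coset_repP.
  rewrite [RHS]big1_seq; last first.
    move=> y /= ys; case: eqP => [yy0|_]; last by rewrite mulr0.
    by rewrite -yy0 ys in y0s.
  have -> : h (x^-1 * g)%g = 0; last by rewrite mulr0.
  apply/eqP; apply: contraNT y0s => /hN.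
  by rewrite -(coset_rep_reps N).
have AT y : mu (A y) = mu (GLO : set G) by exact: mu_lcoset_GLO.
rewrite /convolution /Cintegral.
have -> : (fun x => complex.Re (one_MnO n F x * h (x^-1 * g)%g)) =
    (fun x => \sum_(y <- reps n F N) complex.Re (c y) * \1_(A y) x).
  apply/funext => x; rewrite fE; elim: (reps n F N) => [|y s IH].
    by rewrite !big_nil.
  rewrite !big_cons -IH.
  by move: (c y) (bigop _ _ _) => [a b] [a' b'] /=; rewrite mulr0 subr0.
have -> : (fun x => complex.Im (one_MnO n F x * h (x^-1 * g)%g)) =
    (fun x => \sum_(y <- reps n F N) complex.Im (c y) * \1_(A y) x).
  apply/funext => x; rewrite fE; elim: (reps n F N) => [|y s IH].
    by rewrite !big_nil.
  rewrite !big_cons -IH.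
  by move: (c y) (bigop _ _ _) => [a b] [a' b'] /=; rewrite mulr0 add0r.
have mA y : measurable (A y) by exact: measurable_lcoset_GLO.
have Afin y : (mu (A y) < +oo)%E by rewrite AT; exact: vol_GLO_fin.
rewrite (Rintegral_sum_indic _ _ mA Afin) (Rintegral_sum_indic _ _ mA Afin).
rewrite -[X in _ = _ * X]/(\sum_(y <- reps n F N) c y).
elim: (reps n F N) => [|y s IH].
  by rewrite !big_nil mulr0.
rewrite !big_cons AT -/vol_GLO mulrDr -IH.
move: (c y) (bigop _ _ _) (bigop _ _ _) => [a b] a' b'.
apply/eqP; rewrite eq_complex /= !mul0r subr0 addr0.
by rewrite ![vol_GLO * _]mulrC !eqxx.
Qed.

End Convolution.

(** * Moebius inversion *)

Section Moebius.
Variables (T : eqType) (V : zmodType) (lt : rel T).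
Hypotheses (lt_trans : transitive lt) (lt_irr : irreflexive lt).

(** Termination measure for the inversion: passing from [x] to a larger [y] loses at least [y]
    itself from the entries above. *)
Lemma count_lt (s : seq T) x y : y \in s -> lt x y ->
  (count (lt y) s < count (lt x) s)%N.
Proof.
move=> + xy; have sub : subpred (lt y) (lt x) by move=> z; apply: lt_trans.
elim: s => // z s IH; rewrite inE /= => /orP[/eqP<-|/IH {}IH].
  by rewrite lt_irr xy add0n add1n ltnS; apply: sub_count.
rewrite -addnS leq_add //.
by case: (lt y z) (sub z) => // ->.
Qed.

Definition moebius_step (s : seq T) (u h : T -> V) : T -> V :=
  fun x => u x - \sum_(y <- s | lt x y) h y.

(** Recursion from the top of the poset, written as an iteration. [(size s).+1] rounds suffice from
    any starting function, since at most [size s] entries of [s] lie above a point. *)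
Definition moebius (s : seq T) (u : T -> V) : T -> V :=
  iter (size s).+1 (moebius_step s u) (fun=> 0).

Lemma moebiusE (s : seq T) (u : T -> V) x :
  moebius s u x = u x - \sum_(y <- s | lt x y) moebius s u y.
Proof.
(* After [m] rounds, the value at a point with fewer than [m] entries above it has forgotten the
   starting function. *)
have eq_iter m : forall h h' z, (count (lt z) s < m)%N ->
    iter m (moebius_step s u) h z = iter m (moebius_step s u) h' z.
  elim: m => // m IH h h' z; rewrite ltnS !iterS => zm.
  rewrite /moebius_step; congr (_ - _).
  rewrite big_seq_cond [RHS]big_seq_cond; apply: eq_bigr => y /andP[ys zy].
  by apply: IH; exact: leq_trans (count_lt ys zy) zm.
(* Performing one more round changes nothing, which is the fixed-point equation. *)
have := eq_iter (size s).+1 (fun=> 0) (moebius_step s u (fun=> 0)) x.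
by rewrite -iterSr; apply; rewrite ltnS count_size.
Qed.

End Moebius.

(** * Lattice sums and their inversion *)

Section Main.
Variables (R : realType) (n : nat) (F : padicFieldType).
Notation G := (GL n F).
Implicit Types (h : G -> R[i]) (g k x y : G).

Lemma bi_invariantl (h : G -> R[i]) k x :
  bi_invariant h -> GLO k -> h (k * x)%g = h x.
Proof. by move=> + kO => /(_ k 1%g x kO (GLO1 n F)); rewrite mulg1. Qed.

Lemma bi_invariantr (h : G -> R[i]) k x :
  bi_invariant h -> GLO k -> h (x * k)%g = h x.
Proof. by move=> + kO => /(_ 1%g k x (GLO1 n F) kO); rewrite mul1g. Qed.

(** The sets [GLge N] form an increasing open exhaustion of [G], so one of them contains the compact
    closure of the support. *)
Lemma hecke_bounded (h : G -> R[i]) :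
  hecke_algebra R n F h -> exists N, forall g, h g != 0 -> GLge N g.
Proof.
move=> [_ hc]; have [N|N M NM g|g _|N hN] := compact_increasing_cover
   (U := fun N => [set g : G | GLge N g]) hc.
- by apply: open_GLO_stable => k g kO /=; rewrite GLgeMl.
- exact: GLgeW.
- exact: GLge_ex.
by exists N => g hg; apply: hN; apply: subset_closure.
Qed.

Lemma compactly_supported_GLge (h : G -> R[i]) N :
  (forall g, h g != 0 -> GLge N g) -> compactly_supported h.
Proof.
move=> hN; apply: subclosed_compact (@compact_GLge n F N) _.
  exact: closed_closure.
have /closure_id -> : closed [set g : G | GLge N g].
  by apply: closed_GLO_stable => k g kO /=; rewrite GLgeMl.
exact: closureS.
Qed.

Lemma compactly_supported_mxge (f : 'M[F]_n -> R[i]) i :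
  (forall A, f A != 0 -> mxge i A) -> compactly_supported f.
Proof.
move=> hi; apply: subclosed_compact (@compact_mxge F i n n) _.
  exact: closed_closure.
have /closure_id -> := @closed_mxge F i n n.
exact: closureS.
Qed.

(** Compactness of the support bounds denominators by some [N1]; compactness of the ball of level
    [- N1] then makes local constancy uniform on it, with modulus [N2]. *)
Lemma Cc_infty_mxP (f : 'M[F]_n -> R[i]) : Cc_infty f <->
  exists N : nat, (forall A, f A != 0 -> mxge (- N%:Z) A) /\
    (forall A B, mxge N%:Z (B - A) -> f B = f A).
Proof.
split=> [[flc fc]|[N [fN fE]]]; last first.
  split; last exact: compactly_supported_mxge fN.
  by move=> A; apply/nbhs_mxge; exists N%:Z; exact: fE.
have [N|N M NM A|A _|N1 hN1] := compact_increasing_cover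
   (U := fun N => [set A : 'M[F]_n | mxge (- N%:Z) A]) fc.
- rewrite openE => A NA; apply/nbhs_mxge; exists (- N%:Z) => B BA.
  exact: mxge_near BA NA.
- by move=> /= h; apply: (mxgeW h); lia.
- exact: mxge_lb.
have fN1 A : f A != 0 -> mxge (- N1%:Z) A.
  by move=> fA; apply: hN1; apply: subset_closure.
have [N|N M NM A|A _|N2 hN2] := compact_increasing_cover
   (U := fun N : nat => [set A | forall B, mxge N%:Z (B - A) -> f B = f A])
   (@compact_mxge F (- N1%:Z) n n).
- rewrite openE => A NA; apply/nbhs_mxge; exists N%:Z => B BA C CB.
  by rewrite (NA B BA); apply: NA; apply: mxge_trans CB BA.
- by move=> /= h B BA; apply: h; apply: (mxgeW BA); lia.
- have /nbhs_mxge[i hi] := flc A; exists `|i|%N => B BA.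
  by apply: hi; apply: (mxgeW BA); lia.
exists (N1 + N2)%N; split => [A /fN1 h|A B BA]; first by apply: (mxgeW h); lia.
have [A1|A1] := boolP (mxge (- N1%:Z) A).
  by apply: (hN2 A A1); apply: (mxgeW BA); lia.
(* From outside the ball, a translation of valuation at least [N1 + N2] cannot enter it, so [f]
   vanishes at both points. *)
have B1 : ~~ mxge (- N1%:Z) B.
  apply: contra A1 => B1.
  by apply: (mxge_near (mxgeBC (mxgeW BA _)) B1); lia.
have f0 C : ~~ mxge (- N1%:Z) C -> f C = 0.
  by move=> nC; apply/eqP; apply: contraNT nC; exact: fN1.
by rewrite !f0.
Qed.

Definition lattice_sum N (h : G -> R[i]) (A : 'M[F]_n) : R[i] :=
  \sum_(y <- reps n F N) h y * (mxge 0 (A *m val (y^-1)%g))%:R.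

(** For [y] in [reps N], writing [A = (A y^-1) y] bounds the support. Moreover [pi^N y^-1] is
    integral, so translating [A] by [pi^N M_n(O)] does not affect the integrality of [A y^-1]. *)
Lemma lattice_sum_Cc_infty N h : Cc_infty (lattice_sum N h).
Proof.
apply/Cc_infty_mxP; exists N; split=> [A|A B BA].
  apply: contraNT => NA; apply/eqP/big1_seq => y /= /mem_reps[/andP[yN _] _].
  case: (boolP (mxge 0 _)) => [h0|_]; last by rewrite mulr0.
  case/negP: NA; rewrite -[A]mulmx1 -(val_mulVg y) mulmxA.
  exact: mxge0M.
apply: eq_big_seq => y /= /mem_reps[/andP[_ yN] _].
have AB : mxge 0 (B *m val (y^-1)%g - A *m val (y^-1)%g).
  by rewrite -mulmxBl -(subrr N%:Z); apply: mxgeM.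
congr (_ * (nat_of_bool _)%:R); apply/idP/idP => hm.
  exact: (mxge_near (mxgeBC AB) hm).
exact: (mxge_near AB hm).
Qed.

(** A left factor in [K] preserves integrality; a right factor [k2] is absorbed by substituting
    [y k2] for [y]. *)
Lemma lattice_sum_bi_invariant N h :
  bi_invariant h -> bi_invariant_mx (lattice_sum N h).
Proof.
move=> h_inv k1 k2 A k1O k2O; rewrite /lattice_sum.
under eq_bigr => y _ do rewrite -!mulmxA mxge_GLOl //.
rewrite -(sum_repsMr _ _ k2O).
  apply: eq_bigr => y _; rewrite invgM val_GLM !mulmxA.
  rewrite -[A *m _ *m _]mulmxA val_mulgV mulmx1.
  by rewrite bi_invariantr.
move=> k y kO; rewrite invgM val_GLM !mulmxA mxge_GLOr; last exact: GLOV.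
by rewrite bi_invariantl.
Qed.

(* The row lattice of [x] is contained in that of [y]. *)
Definition row_le x y := mxge 0 (val x *m val (y^-1)%g).

Lemma row_le_refl : reflexive row_le.
Proof. by move=> x; rewrite /row_le val_mulgV mxge1. Qed.

Lemma row_le_trans : transitive row_le.
Proof.
move=> y x z xy yz; rewrite /row_le.
have -> : val x *m val (z^-1)%g =
    (val x *m val (y^-1)%g) *m (val y *m val (z^-1)%g).
  by rewrite !mulmxA -[_ *m val y]mulmxA val_mulVg mulmx1.
exact: mxge0M.
Qed.

Lemma row_le_antisym x y : row_le x y -> row_le y x -> GLO (x * y^-1)%g.
Proof. by move=> xy yx; apply: GLOI; rewrite ?invgM ?invgK val_GLM. Qed.

Lemma row_leMl k1 k2 x y : GLO k1 -> GLO k2 ->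
  row_le (k1 * x)%g (k2 * y)%g = row_le x y.
Proof.
move=> k1O k2O; rewrite /row_le invgM !val_GLM !mulmxA mxge_GLOr.
  by rewrite -mulmxA mxge_GLOl.
exact: GLOV.
Qed.

Lemma row_leMr k x y : row_le (x * k)%g (y * k)%g = row_le x y.
Proof. by rewrite /row_le -!val_GLM invgM mulgA mulgK. Qed.

(* The guard [GLge N x] makes Moebius inversion leave a function that vanishes
   outside [GLge N] zero there. *)
Definition row_lt N x y := [&& GLge N x, row_le x y & ~~ row_le y x].

Lemma row_lt_trans N : transitive (row_lt N).
Proof.
move=> y x z /and3P[xN xy yx] /and3P[yN yz zy]; apply/and3P; split => //.
  exact: row_le_trans xy yz.
by apply: contra zy => zx; exact: row_le_trans zx xy.
Qed.

Lemma row_lt_irr N : irreflexive (row_lt N).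
Proof. by move=> x; rewrite /row_lt row_le_refl !andbF. Qed.

Lemma row_ltMl N k1 k2 x y : GLO k1 -> GLO k2 ->
  row_lt N (k1 * x)%g (k2 * y)%g = row_lt N x y.
Proof. by move=> k1O k2O; rewrite /row_lt GLgeMl // !row_leMl. Qed.

Lemma row_ltMr N k x y : GLO k ->
  row_lt N (x * k)%g (y * k)%g = row_lt N x y.
Proof. by move=> kO; rewrite /row_lt GLgeMr // !row_leMr. Qed.

(** Bi-invariance survives each round: a right factor shifts the sum over cosets, compatibly with
    the order, and a left factor changes no row lattice. *)
Lemma moebius_bi_invariant N (u : G -> R[i]) :
  bi_invariant u -> bi_invariant (moebius (row_lt N) (reps n F N) u).
Proof.
move=> u_inv; rewrite /moebius; elim: _.+1 => [//|m].
rewrite iterS; set h := iter m _ _ => h_inv k1 k2 g k1O k2O.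
rewrite /moebius_step u_inv //; congr (_ - _).
rewrite big_mkcond [RHS]big_mkcond /= -(sum_repsMr _ _ k2O).
  apply: eq_bigr => y _; rewrite bi_invariantr // row_ltMr //.
  by rewrite -[y in row_lt _ _ y]mul1g row_ltMl //; exact: GLO1.
move=> k y kO; rewrite bi_invariantl //.
by rewrite -[X in row_lt _ X (k * y)%g]mul1g row_ltMl //; exact: GLO1.
Qed.

(** The sum runs over the lattices containing that of [g]: the coset of [g] contributes [h g], and
    the strictly larger ones give the sum in the inversion equation. *)
Lemma lattice_sum_unit N (u : G -> R[i]) g :
  bi_invariant u -> GLge N g ->
  lattice_sum N (moebius (row_lt N) (reps n F N) u) (val g) = u g.
Proof.
move=> u_inv gN; set h := moebius _ _ _.
have h_inv : bi_invariant h by exact: moebius_bi_invariant.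
have hE : h g = u g - \sum_(y <- reps n F N | row_lt N g y) h y.
  by apply: moebiusE; [exact: row_lt_trans|exact: row_lt_irr].
have -> : u g = h g + \sum_(y <- reps n F N | row_lt N g y) h y.
  by rewrite hE subrK.
have g0s : coset_rep g \in reps n F N by rewrite coset_rep_reps.
have g_le : row_le g (coset_rep g).
  by rewrite -[g in row_le g _]mul1g -(mulgVK g (coset_rep g)) row_leMl
    ?row_le_refl //; [exact: GLO1|exact: coset_repP].
have le_g : row_le (coset_rep g) g.
  by rewrite -[X in row_le _ X]mul1g -(mulgVK g (coset_rep g)) row_leMl
    ?row_le_refl //; [exact: coset_repP|exact: GLO1].
rewrite /lattice_sum (bigD1_seq (coset_rep g)) ?reps_uniq //=.
rewrite -/(row_le g (coset_rep g)) g_le mulr1; congr (_ + _).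
  by apply: coset_repE => k x kO; exact: bi_invariantl.
rewrite [RHS]big_mkcond [RHS](bigD1_seq (coset_rep g)) ?reps_uniq //=.
rewrite {1}/row_lt le_g !andbF add0r.
rewrite big_seq_cond [RHS]big_seq_cond; apply: eq_bigr => y /andP[ys yg].
rewrite -/(row_le g y) /row_lt gN /=.
case: (boolP (row_le g y)) => gy /=; last by rewrite mulr0.
(* Mutual inclusion would make [y] the representative of the coset of [g], already split off. *)
rewrite mulr1; case: (boolP (row_le y g)) => //= y_g.
have [_ yE] := (mem_reps N y).1 ys.
case/negP: yg; rewrite -yE eq_sym.
by apply/eqP/coset_rep_eqP; exact: row_le_antisym.
Qed.

Lemma moebius_support N (u : G -> R[i]) g :
  (forall x, u x != 0 -> GLge N x) ->
  moebius (row_lt N) (reps n F N) u g != 0 -> GLge N g.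
Proof.
move=> uN; apply: contraNT => gN.
rewrite moebiusE; [|exact: row_lt_trans|exact: row_lt_irr].
rewrite big1 ?subr0; last by move=> y; rewrite /row_lt (negbTE gN).
by apply: contraNT gN => /uN.
Qed.

(** Inversion is applied to [f] truncated to [GLge N]; the other [g] with denominators bounded by
    [N] are reached by saturation, which changes neither side. *)
Lemma lattice_sum_surjective (f : 'M[F]_n -> R[i]) :
  Cc_infty f -> bi_invariant_mx f ->
  exists N h, [/\ bi_invariant h, forall g, h g != 0 -> GLge N g &
    forall g, lattice_sum N h (val g) = f (val g)].
Proof.
move=> /Cc_infty_mxP[N [fN fE]] f_inv.
pose u g := if GLge N g then f (val g) else 0.
have u_inv : bi_invariant u.
  move=> k1 k2 g k1O k2O; rewrite /u GLgeMr // GLgeMl //.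
  by rewrite !val_GLM f_inv.
have uN g : u g != 0 -> GLge N g by rewrite /u; case: ifP; rewrite ?eqxx.
exists N, (moebius (row_lt N) (reps n F N) u); split.
- exact: moebius_bi_invariant.
- by move=> g; exact: moebius_support.
(* If the denominators of [g] are too large, [f] vanishes there and no lattice in the sum contains
   the rows of [g]. *)
move=> g; have [gN|gN] := boolP (mxge (- N%:Z) (val g)); last first.
  have -> : f (val g) = 0 by apply/eqP; apply: contraNT gN; exact: fN.
  apply: big1_seq => y /= ys.
  have [/andP[yN _] _] := (mem_reps N y).1 ys.
  case: (boolP (mxge 0 _)) => [h0|_]; last by rewrite mulr0.
  case/negP: gN; rewrite -[val g]mulmx1 -(val_mulVg y) mulmxA.
  exact: mxge0M.
(* [B] spans the row lattice of [g] enlarged by [pi^N O^n]; being congruent to [val g] modulo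
   [pi^N], it gives [f] the same value. *)
have [B [Bg [[E E0 gE] [W WN WB]]]] := saturation_ex N%:Z (val g).
have Bu : B \in unitmx by case/mulmx1_unit: WB.
pose g' : G := Sub B Bu.
have g'V : val (g'^-1)%g = W.
  by rewrite val_GLV SubK -[LHS]mul1mx -WB -mulmxA mulmxV // mulmx1.
have g'N : GLge N g'.
  by rewrite /GLge g'V WN andbT SubK; apply: (mxge_near (mxgeW Bg _) gN); lia.
have g'E : val g' = B by rewrite SubK.
rewrite -(fE _ _ Bg) -g'E.
have <- : u g' = f (val g') by rewrite /u g'N.
rewrite -(lattice_sum_unit u_inv g'N); apply: eq_big_seq => y ys.
have [/andP[_ yN] _] := (mem_reps N y).1 ys.
(* The lattice of each [y] contains [pi^N O^n], so it contains the rows of [g] exactly when it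
   contains those of [B]. *)
congr (_ * (nat_of_bool _)%:R); rewrite g'E; apply/idP/idP => h0.
  apply: (mxge_near _ h0); rewrite -mulmxBl -(subrr N%:Z); exact: mxgeM.
by rewrite gE -mulmxA; exact: mxge0M.
Qed.

End Main.

Theorem proposition2p2p2 (R : realType) (F : padicFieldType) (n : nat)
    (mu : {measure set (borelGL n F) -> \bar R}) (mu_Haar : is_Haar mu) :
  S_std R n F =
  [set convolution mu (one_MnO n F) h | h in hecke_algebra R n F].
Proof.
set c : R[i] := (vol_GLO mu)%:C%C.
have c0 : c != 0 by rewrite /c (inj_eq (@complexI R) _ 0) vol_GLO_neq0.
apply/seteqP; split=> [_ [f [fC f_inv] <-]|_ [h hH <-]].
  have [N [h [h_inv hN hf]]] := lattice_sum_surjective fC f_inv.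
  have ch_inv : bi_invariant (fun g => c^-1 * h g).
    by move=> k1 k2 g k1O k2O; rewrite h_inv.
  have chN g : c^-1 * h g != 0 -> GLge N g.
    by rewrite mulf_eq0 negb_or => /andP[_ /hN].
  (* Dividing by the volume of [K] cancels the factor in front of the lattice sum. *)
  exists (fun g => c^-1 * h g).
    by split => //; exact: compactly_supported_GLge chN.
  apply/funext => g.
  rewrite (convolution_one_MnOE mu_Haar _ ch_inv chN) -/c -hf.
  rewrite /lattice_sum mulr_sumr; apply: eq_bigr => y _.
  by rewrite !mulrA divff // mul1r.
have [N hN] := hecke_bounded hH; have [h_inv _] := hH.
(* The scaled lattice sum extends the convolution from [G] to all matrices. *)
exists (fun A => c * lattice_sum N h A).
  split; last first.
    by move=> k1 k2 A k1O k2O; rewrite lattice_sum_bi_invariant.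
  have /Cc_infty_mxP[M [MA MB]] := lattice_sum_Cc_infty N h.
  apply/Cc_infty_mxP; exists M; split=> [A|A B /MB -> //].
  by rewrite mulf_eq0 negb_or => /andP[_ /MA].
by apply/funext => g; rewrite (convolution_one_MnOE mu_Haar _ h_inv hN).
Qed.
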